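(* Let $m,n,k$ be positive integers with $k<\min(m,n)$. Then the minimal dimension of a $k$-transitive linear subspace of $\mathbb{M}_{mn}$ is $k(m+n-k)$; that is, every $k$-transitive subspace $\mathcal{L}\subseteq\mathbb{M}_{mn}$ satisfies $\dim\mathcal{L}\ge k(m+n-k)$, and there exists a $k$-transitive subspace of $\mathbb{M}_{mn}$ of dimension exactly $k(m+n-k)$.
   Context: $\mathbb{M}_{mn}$ is the complex vector space of $m\times n$ complex matrices, identified with the linear maps $\mathbb{C}^n\to\mathbb{C}^m$. A linear subspace $\mathcal{L}\subseteq\mathbb{M}_{mn}$ is $k$-transitive if for every choice of $k$ linearly independent vectors $x_1,\dots,x_k\in\mathbb{C}^n$ and arbitrary vectors $y_1,\dots,y_k\in\mathbb{C}^m$ there is $A\in\mathcal{L}$ with $Ax_i=y_i$ for $1\le i\le k$. *)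

(* Defs.v *)
From mathcomp Require Import all_boot all_order all_algebra.
Set Implicit Arguments.
Unset Strict Implicit.
Unset Printing Implicit Defensive.
Import GRing.Theory.
Local Open Scope ring_scope.

(* Vectors are columns, so that a matrix in 'M_(m, n) acts on the left as a   *)
(* linear map from F^n to F^m.                                                *)
Definition k_transitive (F : fieldType) (m n k : nat)
    (L : {vspace 'M[F]_(m, n)}) : Prop :=
  forall (x : k.-tuple 'cV[F]_n) (y : k.-tuple 'cV[F]_m),
    free x ->
    exists2 A : 'M[F]_(m, n), A \in L &
      forall i : 'I_k, A *m tnth x i = tnth y i.
Arguments k_transitive {F m n} k L.

(* Main.v *)
Require Import Defs.
From HB Require Import structures.
From mathcomp Require Import all_boot all_order all_algebra.
From mathcomp Require Import boolp reals.
From mathcomp Require Import complex.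
From mathcomp Require Import mpoly zify.
Set Implicit Arguments.
Unset Strict Implicit.
Unset Printing Implicit Defensive.
Import GRing.Theory.
Local Open Scope ring_scope.

(** Annihilators are taken for the pairing tr (A N) of m x n with n x m matrices.
    A space L of m x n matrices fails to be k-transitive
    exactly when, for some n x k matrix X with independent columns, the map
    A |-> A X sends L into a hyperplane {Y | tr (B Y) = 0} with B <> 0; then
    X B is a nonzero matrix of rank at most k in the annihilator of L.  Since
    every matrix of rank at most k is such a product, L is k-transitive iff its
    annihilator contains no nonzero matrix of rank at most k
    ([k_transitive_annihilator], [annihilator_k_transitive]).  As
    m n - k (m + n - k) = (m - k) (n - k), both halves of the theorem become
    statements on spaces W without nonzero matrices of rank at most k: such a W
    has codimension at least k (m + n - k), and this bound is attained.

    Lower bound.  The matrices of rank at most k form a cone D which has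
    dimension d = k (m + n - k), and a linear subspace meeting a projective
    variety nowhere has codimension greater than the dimension of the variety.
    The following elementary argument gives this.  Choose coordinates
    z_0, z_1, ... in which W is the set where the first c = codim W coordinates
    vanish, and eliminate the remaining ones from the last to the first.  If the
    last coordinate axis is not in D, some homogeneous polynomial vanishes on D
    but not on that axis, that is, it is monic in the last coordinate: this
    coordinate is integral on D over the previous ones.  Integrality lets every
    point of the closure of the projection of D be lifted to the closure of D
    ([lift_closure_point]), so the hypothesis that W meets D in 0 only is
    inherited by the projection.  At the end, all coordinate functions on D are
    integral over the first c, so the functions on D given by polynomials of
    degree at most t lie in a space of dimension O(t^c) ([spanned_section]).  On
    the other hand the d entries in the first k rows or columns are
    algebraically independent on D, because a matrix with invertible leading
    k x k block has a completion of rank k; hence this dimension grows at least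
    like t^d ([growth_lower_bound]).  Therefore d <= c ([dim_no_low_rank]).

    Attainment.  On every diagonal impose the first k power-moment conditions
    on the entries, for distinct nodes.  By interpolation, a nonzero vector with
    at most k nonzero entries cannot satisfy them, so the extreme nonzero
    diagonal of a nonzero solution has more than k nonzero entries
    ([diagonal_large]); the rows and columns through these entries form a
    triangular submatrix, so the rank exceeds k ([diagonal_rank]).  The
    conditions can be indexed by the cells in the first k rows or columns, of
    which there are k (m + n - k). *)

(** * Lifting points along an integral extension *)

Lemma eigenvector_horner_mx (F : fieldType) n (A : 'M[F]_n.+1) (v : 'rV_n.+1)
    (a : F) (h : {poly F}) :
  v *m A = a *: v -> v *m horner_mx A h = h.[a] *: v.
Proof.
move=> vA; elim/poly_ind: h => [|h c IHh].
  by rewrite rmorph0 mulmx0 horner0 scale0r.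
rewrite rmorphD rmorphM /= horner_mx_X horner_mx_C mulmxDr mulmxA IHh.
by rewrite -scalemxAl vA scalerA mul_mx_scalar hornerMXaddC scalerDl.
Qed.

(** [phi] is a family of points of the ring [R], and [psi] is a point of its
    closure: it kills what all the [phi t] kill.  A function [xi] on the family
    extends each [phi t] to [{poly R}].  The aim is to extend [psi] to a point of
    the closure of the extended family.

    With [R] a ring of polynomials in the first coordinates, [xi] is the next
    coordinate, and this is lying over for the projection that forgets it. *)
Section PointLifting.

Variables (F : closedFieldType) (R : comNzRingType) (T : Type).
Variables (phi : T -> {rmorphism R -> F}) (psi : {rmorphism R -> F}).
Hypothesis psi_closure :
  forall r : R, (forall t, phi t r = 0) -> psi r = 0.
Variables (xi : T -> F).

Let vanishes (h : {poly R}) := forall t, (map_poly (phi t) h).[xi t] = 0.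

(** The determinant of [horner_mx A h] is the norm of [h] from
    [{poly R} / (char_poly A)] to [R].  At each point of the family [xi t] is an
    eigenvalue of [A], so [h.[xi t] = 0] makes [horner_mx A h] singular. *)
Lemma norm_vanishes n (A : 'M[R]_n.+1) (h : {poly R}) :
  vanishes (char_poly A) -> vanishes h ->
  forall t, phi t (\det (horner_mx A h)) = 0.
Proof.
move=> gT hT t; have /eigenvalueP[v vA v0] : eigenvalue (map_mx (phi t) A) (xi t).
  by rewrite eigenvalue_root_char -map_char_poly; apply/rootP/gT.
apply/eqP; rewrite -det_map_mx map_horner_mx; apply/det0P; exists v => //.
by rewrite (eigenvector_horner_mx _ vA) hT scale0r.
Qed.

(** The norm of [h] modulo the monic [g] vanishes on the family, hence at [psi],
    where it is a power of [c]. *)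
Lemma vanishes_not_const (g h : {poly R}) (c : F) :
  g \is monic -> vanishes g -> vanishes h -> map_poly psi h = c%:P -> c = 0.
Proof.
move=> g_mon gT hT hc.
have [s [A]] : exists s, exists A : 'M[R]_s, char_poly A = g.
  by exists (size g).-1, (companionmx g); apply: companionmxK.
case: s A => [|s] A Ag.
  (* Here g = 1, so 1 vanishes on the family. *)
  have /eqP : psi 1 = 0.
    apply: psi_closure => t; move: (gT t).
    by rewrite -Ag /char_poly det_mx00 !rmorph1 hornerE.
  by rewrite rmorph1 oner_eq0.
have := psi_closure (norm_vanishes (A := A) (h := h) _ hT).
rewrite Ag => /(_ gT); rewrite -det_map_mx map_horner_mx hc horner_mx_C.
by rewrite det_scalar => /eqP; rewrite expf_eq0 => /andP[_ /eqP].
Qed.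

Hypothesis psi_surj : forall c : F, exists r : R, psi r = c.

Let lift_poly (f : {poly F}) : exists h : {poly R}, map_poly psi h = f.
Proof.
elim/poly_ind: f => [|f c [h hf]]; first by exists 0; rewrite rmorph0.
have [r rc] := psi_surj c; exists (h * 'X + r%:P).
by rewrite rmorphD rmorphM /= hf map_polyX map_polyC /= rc.
Qed.

(** The specializations at [psi] of the polynomials vanishing on the family.
    This is an ideal of [{poly F}] since [psi] is onto; the next two facts are
    the Euclidean proof that it is principal. *)
Let J (f : {poly F}) := exists2 h, vanishes h & map_poly psi h = f.

Let J_mod f1 f2 : J f1 -> J f2 -> J (f1 %% f2).
Proof.
move=> [h1 h1T <-] [h2 h2T <-].
have [q qf] := lift_poly (map_poly psi h1 %/ map_poly psi h2).
exists (h1 - q * h2).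
  by move=> t; rewrite rmorphB rmorphM /= hornerD hornerN hornerM h1T h2T mulr0 subr0.
rewrite rmorphB rmorphM /= qf.
by rewrite {1}(divp_eq (map_poly psi h1) (map_poly psi h2)) addrAC subrr add0r.
Qed.

Let J_gen f : J f -> f != 0 ->
  exists f0, [/\ J f0, f0 != 0 & forall f', J f' -> f0 %| f'].
Proof.
have [n] := ubnP (size f); elim: n f => // n IHn f; rewrite ltnS => fn Jf f0.
have [dvd|/existsNP[f' /not_implyP[Jf' /negP ndvd]]] :=
  pselect (forall f', J f' -> f %| f').
  by exists f.
apply: (IHn (f' %% f)).
- by apply: leq_trans fn; rewrite ltn_modp.
- exact: J_mod.
- by apply: contraNneq ndvd => /modp_eq0P.
Qed.

(** A common root of the ideal [J] extends [psi].  [J] is principal, and its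
    generator has a root unless it is a nonzero constant, which
    [vanishes_not_const] excludes. *)
Lemma lift_closure_point (g : {poly R}) : g \is monic -> vanishes g ->
  exists x : F, forall h, vanishes h -> (map_poly psi h).[x] = 0.
Proof.
move=> g_mon gT; have Jg : J (map_poly psi g) by exists g.
have [|f [Jf f0 fdvd]] := J_gen Jg.
  by rewrite monic_neq0 // monic_map.
have /closed_rootP[x xf] : size f != 1.
  apply/negP => /size_poly1P[c c0 fc]; case: Jf => h hT hf.
  by case/eqP: c0; apply: (vanishes_not_const g_mon gT hT); rewrite hf.
exists x => h hT; apply/rootP.
have /dvdpP[q ->] : f %| map_poly psi h by apply: fdvd; exists h.
by rewrite rootM xf orbT.
Qed.

End PointLifting.

(** * Polynomials as polynomials in the last variable *)

Section Unravelling.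

Variables (F : fieldType) (n : nat).
Implicit Types (p : {mpoly F[n.+1]}) (g h r : {poly {mpoly F[n]}}).

Lemma meval_muni (v : 'I_n.+1 -> F) p :
  (map_poly (meval (fun i : 'I_n => v (widen_ord (leqnSn n) i))) (muni p)).[v ord_max]
  = p.@[v].
Proof.
rewrite muniE mevalE rmorph_sum horner_sum; apply: eq_bigr => m _.
rewrite -!mul_polyC !rmorphM /= map_polyC map_polyXn hornerM hornerC hornerXn /=.
rewrite mevalZ mevalX big_ord_recr /= mulrA; congr (_ * _ * _).
by apply: eq_bigr => i _; rewrite mnmE.
Qed.

Lemma coef_muni p i : (muni p)`_i =
  \sum_(m <- msupp p | m ord_max == i)
     p@_m *: 'X_[[multinom (m (widen_ord (leqnSn n) j)) | j < n]].
Proof.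
rewrite muniE coef_sum [RHS]big_mkcond; apply: eq_bigr => m _.
rewrite coefZ coefXn eq_sym; case: eqP => _; first by rewrite mulr1.
by rewrite mulr0.
Qed.

Lemma mdeg_ord_recr (m : 'X_{1..n.+1}) :
  mdeg m = (mdeg [multinom (m (widen_ord (leqnSn n) j)) | j < n] + m ord_max)%N.
Proof.
rewrite !mdegE big_ord_recr /=; congr (_ + _)%N.
by apply: eq_bigr => i _; rewrite mnmE.
Qed.

(** The total degree of [h] is at most [t], where the polynomial variable has
    degree 1.  For [t < i] the truncated difference is 0 and forces [h`_i = 0]. *)
Definition weight_bounded t h := forall i, (msize h`_i <= t.+1 - i)%N.

Lemma weight_bounded_muni t p : (msize p <= t.+1)%N -> weight_bounded t (muni p).
Proof.
move=> pt i; rewrite coef_muni; apply: leq_trans (mmeasure_sum _ _ _ _) _.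
rewrite big_seq_cond; apply: (big_ind (fun a => a <= t.+1 - i)%N) => //.
  by move=> a b ha hb; rewrite geq_max ha.
move=> m /andP[mp /eqP mi]; apply: leq_trans (msizeZ_le _ _) _.
rewrite msizeX leq_subRL.
  by rewrite addnC addSn -mi -mdeg_ord_recr; apply: leq_trans pt; apply: msize_mdeg_lt.
rewrite -mi; apply: leq_trans pt; apply: leq_trans (msize_mdeg_lt mp).
by rewrite ltnW // ltnS mdeg_ord_recr leq_addl.
Qed.

(** This detects monicity: in a form of degree [s], the coefficient of the
    [s]-th power of the last variable is its value on the last axis. *)
Lemma mcoeff0_coef_muni p i : ((muni p)`_i)@_0 = p@_(U_(ord_max) *+ i).
Proof.
rewrite coef_muni [in RHS](mpolyE p) !raddf_sum big_mkcond /=.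
apply: eq_bigr => m _; rewrite !mcoeffZ !mcoeffX.
case: ifPn => [/eqP mi|mi].
  congr (_ * _%:R); congr nat_of_bool; apply/eqP/eqP => [m0|->].
    apply/mnmP => j; rewrite mulmnE mnm1E.
    case: (unliftP ord_max j) => [l ->|->]; last by rewrite eqxx mul1n.
    rewrite (negPf (neq_lift _ _)) mul0n.
    have /(congr1 (fun a : 'X_{1..n} => a l)) := m0; rewrite !mnmE => <-.
    by congr (m _); apply: val_inj; rewrite /= /bump leqNgt ltn_ord.
  apply/mnmP => j; rewrite !mnmE mulmnE mnm1E.
  by rewrite -val_eqE /= gtn_eqF ?mul0n.
case: eqP => [mE|]; last by rewrite mulr0.
by rewrite mE mulmnE mnm1E eqxx mul1n eqxx in mi.
Qed.

(** Division by a monic form of degree [s] does not raise the total degree of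
    the remainder: each step subtracts a multiple of [g] whose total degree is
    that of the leading term. *)
Lemma weight_bounded_mod s g t h :
  g`_s = 1 -> weight_bounded s g -> weight_bounded t h ->
  exists q r, [/\ h = q * g + r, (size r <= s)%N & weight_bounded t r].
Proof.
move=> gs gB; have g_top i : (s < i)%N -> g`_i = 0.
  move=> si; apply/eqP; rewrite -(mmeasure_poly_eq0 mdeg) -leqn0.
  by apply: leq_trans (gB i) _; rewrite leqn0 subn_eq0.
have [N] := ubnP (size h); elim: N h => // N IHN h; rewrite ltnS => hN hB.
have [hs|sh] := leqP (size h) s; first by exists 0, h; rewrite mul0r add0r.
pose a := (size h).-1; have ha : size h = a.+1 by rewrite /a prednK //; case: (size h) sh.
have sa : (s <= a)%N by rewrite -ltnS -ha.
pose h' := h - (h`_a)%:P * 'X^(a - s) * g.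
have h'E i : h'`_i = h`_i - h`_a * (if (i < a - s)%N then 0 else g`_(i - (a - s))).
  by rewrite coefB -mulrA coefCM coefXnM.
have [||q [r [qr rs rB]]] := IHN h'.
- apply: leq_trans hN; rewrite ha ltnS; apply/leq_sizeP => i ai.
  rewrite h'E ltnNge (leq_trans (leq_subr _ _) ai) /=.
  move: ai; rewrite leq_eqVlt => /orP[/eqP<-|ai].
    by rewrite subKn // gs mulr1 subrr.
  rewrite g_top ?mulr0 ?subr0; last first.
    by rewrite ltn_subRL subnK.
  by apply/(leq_sizeP _ _ (leqnn (size h))); rewrite ha.
- move=> i; rewrite h'E; case: ltnP => ai; first by rewrite mulr0 subr0.
  apply: leq_trans (mmeasureD_le _ _ _) _; rewrite geq_max hB mmeasureN /=.
  set j := (i - (a - s))%N.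
  have [->|ha0] := eqVneq h`_a 0; first by rewrite mul0r mmeasure0.
  have [->|gj0] := eqVneq g`_j 0; first by rewrite mulr0 mmeasure0.
  rewrite msizeM //; have := hB a; have := gB j.
  move: ha0 gj0; rewrite -!(mmeasure_poly_eq0 mdeg).
  by rewrite /j; move: (msize _) (msize _) => x y; lia.
exists (q + (h`_a)%:P * 'X^(a - s)), r; split=> //.
by rewrite mulrDl addrAC -qr /h' subrK.
Qed.

End Unravelling.

(** * Elimination for cones *)

(** Points are infinite sequences of which polynomials in [n] variables see the
    first [n] terms, so that a projection keeps the same family of points. *)
Definition prefix (F : Type) n (z : nat -> F) : 'I_n -> F := fun i => z i.
Arguments prefix {F} n z.

Lemma meval_muni_prefix (F : fieldType) n (p : {mpoly F[n.+1]}) z :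
  (map_poly (meval (prefix n z)) (muni p)).[z n] = p.@[prefix n.+1 z].
Proof.
rewrite -meval_muni; congr (_.[_]); apply: eq_map_poly => r; exact: meval_eq.
Qed.

Section Cones.

Variables (F : closedFieldType) (T : Type) (x : T -> nat -> F).
Hypothesis x_cone :
  forall t (c : F), exists t', forall i, x t' i = c * x t i.

Definition vanishes_on n (p : {mpoly F[n]}) :=
  forall t, p.@[prefix n (x t)] = 0.

Definition in_closure n (q : nat -> F) :=
  forall p : {mpoly F[n]}, vanishes_on p -> p.@[prefix n q] = 0.

(** Along the line through a point, a polynomial is a polynomial in the scaling
    factor, and its coefficients are the values of the homogeneous components. *)
Lemma vanishes_on_pihomog n (p : {mpoly F[n]}) d :
  vanishes_on p -> vanishes_on (pihomog mdeg d p).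
Proof.
move=> pT t; pose Q : {poly F} :=
  \sum_(m <- msupp p) (p@_m * ('X_[m] : {mpoly F[n]}).@[prefix n (x t)]) *: 'X^(mdeg m).
have Q0 : Q = 0.
  apply/eqP; apply: contraT => /closed_nonrootP[c]; rewrite /root.
  have [t' xt'] := x_cone t c; case/eqP; rewrite -[RHS](pT t') mevalE horner_sum.
  apply: eq_bigr => m _; rewrite hornerZ hornerXn mevalX -mulrA; congr (_ * _).
  rewrite mdegE -prodrXr -big_split /=; apply: eq_bigr => i _.
  by rewrite /prefix xt' exprMn mulrC.
have /(congr1 (fun P : {poly F} => P`_d)) := Q0; rewrite coef0 => <-.
rewrite coef_sum pihomogE rmorph_sum /= big_mkcond; apply: eq_bigr => m _.
rewrite coefZ coefXn eq_sym; case: eqP => _; last by rewrite mulr0.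
by rewrite mevalZ mulr1.
Qed.

Definition vanishes_on_poly n (h : {poly {mpoly F[n]}}) :=
  forall t, (map_poly (meval (prefix n (x t))) h).[x t n] = 0.

(** If the last axis is outside the closure of the cone, some form vanishing on
    the cone is nonzero on that axis, i.e. it is monic, up to a constant, in the
    last coordinate. *)
Lemma integral_last_coordinate n :
  ~ in_closure n.+1 (fun i => (i == n)%:R) ->
  exists s (g : {poly {mpoly F[n]}}), [/\ g`_s = 1, weight_bounded s g & vanishes_on_poly g].
Proof.
move=> /existsNP[p /not_implyP[pT /eqP pn]].
(* Only powers of the last variable contribute to the value on the axis. *)
have [s ps] : exists s, p@_(U_(ord_max) *+ s) != 0.
  apply: contrapT => /forallNP p0; case/eqP: pn.
  rewrite mevalE big1 // => m _.
  have [->|mN] := eqVneq m (U_(ord_max) *+ (m ord_max))%MM.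
    by have /negP/negPn/eqP-> := p0 (m ord_max); rewrite mul0r.
  have [j jmax mj] : exists2 j : 'I_n.+1, j != ord_max & m j != 0%N.
    apply: contrapT => mE; case/eqP: mN; apply/mnmP => j.
    rewrite mulmnE mnm1E; case: eqP => [<-|/eqP]; first by rewrite mul1n.
    rewrite eq_sym mul0n => jmax; apply/eqP; apply: contrapT => mj.
    by case: mE; exists j => //; apply/negP.
  rewrite (bigD1 j) //= [prefix _ _ _](_ : _ = 0) ?expr0n ?(negPf mj) ?mul0r ?mulr0 //.
  by rewrite /prefix -val_eqE in jmax *; rewrite (negPf jmax).
pose p' := pihomog mdeg s p.
have p's : p'@_(U_(ord_max) *+ s) = p@_(U_(ord_max) *+ s).
  rewrite /p' pihomogE [in RHS](mpolyE p) !raddf_sum big_mkcond /=.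
  apply: eq_bigr => m _; case: eqP => // ms; rewrite mcoeffZ mcoeffX.
  case: eqP => [mE|]; last by rewrite mulr0.
  by case: ms; rewrite mE mdegMn mdeg1 mul1n.
have p'B : (msize p' <= s.+1)%N.
  rewrite msizeE; apply/bigmax_leqP_seq => m mp _.
  by have /dhomogP/(_ m mp) -> := pihomogP mdeg s p.
have gB := weight_bounded_muni p'B.
have gs : (muni p')`_s = (p@_(U_(ord_max) *+ s))%:MP.
  rewrite [LHS]msize1_polyC; first by rewrite mcoeff0_coef_muni p's.
  by apply: leq_trans (gB s) _; rewrite subSnn.
exists s, ((p@_(U_(ord_max) *+ s))^-1%:MP *: muni p'); split.
- by rewrite coefZ gs -mpolyCM mulVf.
- move=> i; rewrite coefZ mul_mpolyC; apply: leq_trans (gB i).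
  exact: msizeZ_le.
- move=> t; rewrite -mul_polyC rmorphM /= map_polyC hornerM.
  have -> : (map_poly (meval (prefix n (x t))) (muni p')).[x t n] = 0.
    by rewrite meval_muni_prefix; apply: vanishes_on_pihomog.
  by rewrite mulr0.
Qed.

(** On the cone, the polynomials in the first [n] coordinates of degree at most
    [t] lie in the span of [M] functions: an upper bound on the affine Hilbert
    function.  The spanning functions are arbitrary, which spares any dimension
    theory for function spaces. *)
Definition spanned n t M :=
  exists (I : finType) (b : I -> T -> F), (#|I| <= M)%N /\
    forall p : {mpoly F[n]}, (msize p <= t.+1)%N ->
      exists a : I -> F, forall tau, p.@[prefix n (x tau)] = \sum_i a i * b i tau.

(** When the last coordinate is integral of degree [s], its powers below [s]
    suffice, with coefficients in the previous coordinates. *)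
Lemma spannedS n s (g : {poly {mpoly F[n]}}) t M :
  g`_s = 1 -> weight_bounded s g -> vanishes_on_poly g ->
  spanned n t M -> spanned n.+1 t (s * M).
Proof.
move=> gs gB gT [I [b [IM bP]]].
exists ('I_s * I)%type, (fun (ji : 'I_s * I) tau => b ji.2 tau * x tau n ^+ ji.1); split.
  by rewrite card_prod card_ord leq_mul2l IM orbT.
move=> p pt; have [q [r [pE rs rB]]] :=
  weight_bounded_mod gs gB (weight_bounded_muni pt).
have /choice[a aP] : forall j : 'I_s, exists a : I -> F, forall tau,
    (r`_j).@[prefix n (x tau)] = \sum_i a i * b i tau.
  by move=> j; apply: bP; apply: leq_trans (rB j) (leq_subr _ _).
exists (fun ji : 'I_s * I => a ji.1 ji.2) => tau.
rewrite -(pair_bigA _ (fun j i => a j i * (b i tau * x tau n ^+ j))) /=.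
rewrite -meval_muni_prefix pE rmorphD rmorphM /= hornerD hornerM gT mulr0 add0r.
rewrite (horner_coef_wide _ (leq_trans (size_poly _ _) rs)).
apply: eq_bigr => j _; rewrite coef_map /= aP mulr_suml.
by apply: eq_bigr => i _; rewrite mulrA.
Qed.

Lemma spanned_all n t : spanned n t (t.+1 ^ n).
Proof.
exists ('X_{1..n < t.+1} : finType),
  (fun (m : 'X_{1..n < t.+1}) tau => ('X_[m] : {mpoly F[n]}).@[prefix n (x tau)]).
split; last first.
  move=> p pt; exists (fun m : 'X_{1..n < t.+1} => p@_m) => tau.
  rewrite [in LHS](mpolywE pt) rmorph_sum; apply: eq_bigr => m _.
  by rewrite /= mevalZ.
pose f (m : 'X_{1..n < t.+1}) : {ffun 'I_n -> 'I_t.+1} := [ffun i => inord (m i)].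
have mt (m : 'X_{1..n < t.+1}) i : (m i < t.+1)%N.
  apply: leq_ltn_trans (bmdeg m); rewrite mdegE (bigD1 i) //=; exact: leq_addr.
have <- : #|{ffun 'I_n -> 'I_t.+1}| = (t.+1 ^ n)%N by rewrite card_ffun !card_ord.
apply: (leq_card f).
move=> m1 m2 /ffunP fm; apply/val_inj/mnmP => i.
by have /(congr1 val) := fm i; rewrite !ffunE /= !inordK.
Qed.

(** The elimination.  The hypothesis says that the linear section of the closure
    of the cone by the vanishing of the first [c] coordinates is trivial.  It
    excludes the last axis from the closure, so the last coordinate is integral
    and can be dropped; the hypothesis survives, since a closure point of the
    projected cone lifts to one of the cone. *)
Lemma spanned_section c e :
  (forall q, in_closure (c + e) q -> (forall i, (i < c)%N -> q i = 0) ->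
     forall i, (i < c + e)%N -> q i = 0) ->
  exists S, forall t, spanned (c + e) t (S * t.+1 ^ c).
Proof.
elim: e => [|e IHe]; first by exists 1%N => t; rewrite addn0 mul1n; apply: spanned_all.
rewrite addnS => trivial_section.
have [|s [g [gs gB gT]]] := @integral_last_coordinate (c + e).
  move=> /trivial_section axis0; have /eqP : (1 : F) = 0.
    rewrite -[RHS](axis0 _ (c + e)%N (ltnSn _)) ?eqxx // => i ic.
    by rewrite ltn_eqF // (leq_trans ic) ?leq_addr.
  by rewrite oner_eq0.
have [|S SP] := IHe; last first.
  by exists (s * S)%N => t; rewrite -mulnA; exact: (spannedS gs gB gT (SP t)).
move=> q qcl qc i ice.
have g_size : (size g <= s.+1)%N.
  apply/leq_sizeP => j sj; apply/eqP; rewrite -(mmeasure_poly_eq0 mdeg) -leqn0.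
  by apply: leq_trans (gB j) _; rewrite leqn0 subn_eq0.
have g_mon : g \is monic.
  have gS : size g = s.+1.
    apply/eqP; rewrite eqn_leq g_size ltnNge; apply/negP => /leq_sizeP/(_ s (leqnn _)).
    by apply/eqP; rewrite gs oner_eq0.
  by rewrite monicE /lead_coef gS gs.
pose phi t : {rmorphism {mpoly F[c + e]} -> F} := meval (prefix (c + e) (x t)).
pose psi : {rmorphism {mpoly F[c + e]} -> F} := meval (prefix (c + e) q).
have [|y yP] := @lift_closure_point _ _ _ phi psi qcl (fun t => x t (c + e)%N) _ _ g_mon gT.
  by move=> a; exists a%:MP; rewrite /psi /= mevalC.
pose q' i := if i == (c + e)%N then y else q i.
have q'E j : (j < c + e)%N -> q' j = q j by move=> jce; rewrite /q' ltn_eqF.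
rewrite -q'E // trivial_section ?(ltnW ice) //.
- move=> p pT; rewrite -meval_muni_prefix [q' _](_ : _ = y); last by rewrite /q' eqxx.
  have := yP (muni p); rewrite /phi /psi /= => <-; last first.
    by move=> t; rewrite meval_muni_prefix.
  congr (_.[_]); apply: eq_map_poly => r; apply: meval_eq => j.
  exact: q'E.
- by move=> j jc; rewrite q'E ?qc // (leq_trans jc) ?leq_addr.
- by rewrite ltnS ltnW.
Qed.

End Cones.

(** * Independent entries of matrices of low rank *)

Lemma base_expansion_inj b n (e f : 'I_n -> 'I_b) :
  (\sum_(i < n) e i * b ^ i = \sum_(i < n) f i * b ^ i)%N -> e =1 f.
Proof.
elim: n e f => [|n IHn] e f; first by move=> _ [].
have shift (g : 'I_n.+1 -> 'I_b) :
    (\sum_(i < n.+1) g i * b ^ i =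
     (\sum_(i < n) g (lift ord0 i) * b ^ i) * b + g ord0)%N.
  rewrite big_ord_recl expn0 muln1 addnC big_distrl /=; congr (_ + _)%N.
  by apply: eq_bigr => i _; rewrite /bump add1n expnSr mulnA.
rewrite !shift => ef.
have b_gt0 : (0 < b)%N by apply: leq_ltn_trans (ltn_ord (e ord0)).
have ef0 : e ord0 = f ord0.
  by apply: val_inj; have /(congr1 (modn^~ b)) := ef; rewrite !modnMDl !modn_small.
have ef' : (fun i => e (lift ord0 i)) =1 (fun i => f (lift ord0 i)).
  apply: IHn; have /(congr1 (divn^~ b)) := ef.
  by rewrite !divnMDl // !divn_small // !addn0.
by move=> i; case: (unliftP ord0 i) => [j ->|->].
Qed.

Lemma poly_fun_inj (F : closedFieldType) (p : {poly F}) :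
  (forall a, p.[a] = 0) -> p = 0.
Proof.
move=> p0; apply/eqP; apply: contraT => /closed_nonrootP[a].
by rewrite /root p0 eqxx.
Qed.

(** Kronecker substitution: the [i]-th variable is replaced by [a ^+ (b ^ i)].
    Exponents below [b] are the digits of the resulting power of [a], so
    distinct monomials become distinct powers, and a polynomial in one variable
    vanishing on an infinite field is zero. *)
Lemma monomials_free (F : closedFieldType) (C : finType) b
    (v : {ffun C -> 'I_b} -> F) :
  (forall y : C -> F, \sum_e v e * \prod_c y c ^+ e c = 0) -> forall e, v e = 0.
Proof.
move=> v0 e0; pose kappa (e : {ffun C -> 'I_b}) :=
  (\sum_(i < #|C|) e (enum_val i) * b ^ i)%N.
have kappa_inj : injective kappa.
  move=> e f /base_expansion_inj ef; apply/ffunP => c.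
  by have := ef (enum_rank c); rewrite enum_rankK.
have /(congr1 (fun p : {poly F} => p`_(kappa e0))) : \sum_e v e *: 'X^(kappa e) = 0.
  apply: poly_fun_inj => a; rewrite -[RHS](v0 (fun c => a ^+ (b ^ enum_rank c))).
  rewrite horner_sum; apply: eq_bigr => e _; rewrite hornerZ hornerXn -prodrXr.
  congr (_ * _); rewrite (reindex (fun i : 'I_#|C| => enum_val i)) /=.
    apply: eq_bigr => i _; rewrite enum_valK -exprM mulnC; congr (_ ^+ _).
  exact/onW_bij/enum_val_bij.
rewrite coef0 coef_sum (bigD1 e0) //= coefZ coefXn eqxx mulr1 big1 ?addr0 //.
by move=> e ne; rewrite coefZ coefXn (inj_eq kappa_inj) eq_sym (negPf ne) mulr0.
Qed.

(** The positions that remain free on the matrices of rank at most [k]. *)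
Definition cells k p q : {set 'I_(k + p) * 'I_(k + q)} :=
  [set c : 'I_(k + p) * 'I_(k + q) | (c.1 < k)%N || (c.2 < k)%N].

(** The complement is a [p] by [q] rectangle. *)
Lemma card_cells k p q : #|cells k p q| = (k * (k + p + q))%N.
Proof.
have cardC r : #|[set i : 'I_(k + r) | (k <= i)%N]| = r.
  have -> : [set i : 'I_(k + r) | (k <= i)%N] = [set rshift k j | j in 'I_r].
    apply/setP => i; rewrite inE; apply/idP/imsetP => [|[j _ ->]]; last exact: leq_addr.
    by case: (splitP i) => [j ->|j iE _]; [rewrite leqNgt ltn_ord | exists j => //; apply: val_inj].
  by rewrite card_imset ?card_ord //; apply: rshift_inj.
have cells_compl : ~: cells k p q =
    setX [set i : 'I_(k + p) | (k <= i)%N] [set j : 'I_(k + q) | (k <= j)%N].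
  by apply/setP => -[i j]; rewrite !inE /= negb_or -!leqNgt.
have := cardsC (cells k p q); rewrite cells_compl cardsX !cardC card_prod !card_ord.
by move: #|_| => x; nia.
Qed.

Section LowRankMatrices.

Variables (F : closedFieldType) (k p q : nat).
Implicit Types N : 'M[F]_(k + p, k + q).

(** The lower right block is forced: it is D A^-1 B, where A, B, D are the other
    blocks, A being the leading one. *)
Lemma low_rank_completion N : ulsubmx N \in unitmx ->
  exists2 N', (\rank N' <= k)%N & forall c, c \in cells k p q -> N' c.1 c.2 = N c.1 c.2.
Proof.
move=> Nu; set A := ulsubmx N in Nu.
exists (col_mx A (dlsubmx N) *m row_mx 1%:M (invmx A *m ursubmx N)).
  exact: mulmx_max_rank.
move=> [i j]; rewrite inE /= => ij.
rewrite -[N in RHS]submxK mul_col_row !mulmx1 mulKVmx // /block_mx !mxE.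
case: splitP => i' ii'; rewrite !mxE; case: splitP => j' jj' //.
by move: ij; rewrite ii' jj' !ltnNge !leq_addr.
Qed.

(** The completion needs an invertible leading block.  Adding [a] times the
    identity to that block makes it invertible except when [a] is a root of a
    characteristic polynomial, so the value at the perturbed matrix, a polynomial
    in [a], is zero as its product with that monic polynomial vanishes
    everywhere. *)
Lemma poly_zero_on_low_rank b (v : {ffun {c | c \in cells k p q} -> 'I_b} -> F) :
  (forall N, (\rank N <= k)%N ->
     \sum_e v e * \prod_c N (val c).1 (val c).2 ^+ e c = 0) ->
  forall N, \sum_e v e * \prod_c N (val c).1 (val c).2 ^+ e c = 0.
Proof.
move=> v0 N; pose E : 'M[F]_(k + p, k + q) := pid_mx k.
pose Q : {poly F} := \sum_e (v e)%:P *
  \prod_c ((N (val c).1 (val c).2)%:P + (E (val c).1 (val c).2)%:P * 'X) ^+ e c.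
have QE a : Q.[a] = \sum_e v e * \prod_c (N + a *: E) (val c).1 (val c).2 ^+ e c.
  rewrite horner_sum; apply: eq_bigr => e _; rewrite hornerM hornerC horner_prod.
  congr (_ * _); apply: eq_bigr => c _.
  rewrite horner_exp hornerD hornerM !hornerC hornerX; congr (_ ^+ _).
  by move: (E) => E'; rewrite !mxE (mulrC a).
have D_mon := char_poly_monic (- ulsubmx N).
have : Q * char_poly (- ulsubmx N) = 0.
  apply: poly_fun_inj => a; rewrite hornerM.
  have [/rootP->|] := boolP (root (char_poly (- ulsubmx N)) a); first by rewrite mulr0.
  rewrite -eigenvalue_root_char negbK kermx_eq0 row_free_unit => Na.
  suff -> : Q.[a] = 0 by rewrite mul0r.
  have [|N' N'k N'E] := @low_rank_completion (N + a *: E).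
    have -> : ulsubmx (N + a *: E) = - (- ulsubmx N - a%:M).
      rewrite opprB opprK addrC; apply/matrixP => i j.
      by rewrite !mxE /= ltn_ord andbT -val_eqE /= mulr_natr.
    by rewrite -scaleN1r unitmxZ // unitrN1.
  rewrite QE -[RHS](v0 _ N'k); apply: eq_bigr => e _; congr (_ * _).
  by apply: eq_bigr => c _; rewrite N'E // (valP c).
move/eqP; rewrite mulf_eq0 (negPf (monic_neq0 D_mon)) orbF => /eqP Q0.
by have := QE 0; rewrite Q0 horner0 scale0r addr0 => <-.
Qed.

End LowRankMatrices.

(** * Codimension of spaces without matrices of low rank *)

(** The family [mx] runs through the matrices of rank at most [k], with
    coordinates [x] in the family [B]. *)
Section Growth.

Variables (F : closedFieldType) (k p q : nat).
Variables (T : Type) (x : T -> nat -> F) (K : nat).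
Variables (mx : T -> 'M[F]_(k + p, k + q)) (B : 'I_K -> 'M[F]_(k + p, k + q)).
Hypothesis mx_onto : forall N, (\rank N <= k)%N -> exists t, mx t = N.
Hypothesis mx_linear : forall t, mx t = \sum_(l < K) x t l *: B l.

Lemma msizeM_leq (f g : {mpoly F[K]}) a b :
  (msize f <= a.+1)%N -> (msize g <= b.+1)%N -> (msize (f * g) <= (a + b).+1)%N.
Proof.
have [->|f0] := eqVneq f 0; first by rewrite mul0r mmeasure0.
have [->|g0] := eqVneq g 0; first by rewrite mulr0 mmeasure0.
by rewrite msizeM //; move: (msize f) (msize g) => i j; lia.
Qed.

Let entry (c : 'I_(k + p) * 'I_(k + q)) : {mpoly F[K]} :=
  \sum_l B l c.1 c.2 *: 'X_l.

Let meval_entry t c : (entry c).@[prefix K (x t)] = mx t c.1 c.2.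
Proof.
rewrite mx_linear summxE rmorph_sum; apply: eq_bigr => l _.
by rewrite /= mevalZ mevalXU mxE mulrC.
Qed.

Let msize_entry c : (msize (entry c) <= 2)%N.
Proof.
apply: leq_trans (mmeasure_sum _ _ _ _) _; apply/bigmax_leqP => l _.
by apply: leq_trans (msizeZ_le _ _) _; rewrite msizeX mdeg1.
Qed.

(** The monomials of degree at most [u] in each free entry are independent on
    the matrices of rank at most [k] and have total degree at most [u] times the
    number of cells, so a span containing them has dimension at least their
    number. *)
Lemma growth_lower_bound u M :
  spanned x K (#|cells k p q| * u) M -> (u.+1 ^ #|cells k p q| <= M)%N.
Proof.
move=> [I [b [IM bP]]]; apply: leq_trans IM.
pose E := {ffun {c | c \in cells k p q} -> 'I_u.+1}.
have cardE : #|{: E}| = (u.+1 ^ #|cells k p q|)%N.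
  by rewrite card_ffun card_ord card_sig; congr (_ ^ _)%N; apply: eq_card.
rewrite -cardE leqNgt; apply/negP => IE.
have /choice[a aP] : forall e : E, exists a : I -> F, forall t,
    \prod_c mx t (val c).1 (val c).2 ^+ e c = \sum_i a i * b i t.
  move=> e; have [|a aP] := bP (\prod_c entry (val c) ^+ e c).
    have -> : (#|cells k p q| * u = \sum_(c : {c | c \in cells k p q}) u)%N.
      by rewrite sum_nat_const card_sig; congr (_ * _)%N; apply: eq_card.
    apply: (big_ind2 (fun (f : {mpoly F[K]}) d => msize f <= d.+1)%N).
    - by rewrite msize1.
    - by move=> f1 d1 f2 d2; apply: msizeM_leq.
    move=> c _; apply: (@leq_trans (e c).+1); last exact: ltn_ord.
    elim: (nat_of_ord (e c)) => [|i IHi]; first by rewrite expr0 msize1.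
    by rewrite exprS; apply: (msizeM_leq (a := 1) (b := i)).
  exists a => t; rewrite -aP rmorph_prod; apply: eq_bigr => c _.
  by rewrite rmorphXn /= meval_entry.
pose A : 'M[F]_(#|{: E}|, #|I|) := \matrix_(i, j) a (enum_val i) (enum_val j).
have : kermx A != 0.
  rewrite kermx_eq0 /row_free neq_ltn; apply/orP; left.
  exact: leq_ltn_trans (rank_leq_col A) IE.
case/rowV0Pn => v /sub_kermxP vA /rV0Pn[i vi]; case/eqP: vi.
suff v0 e : v 0 (enum_rank e) = 0 by rewrite -(enum_valK i); apply: v0.
apply: (@monomials_free F _ u.+1 (fun e => v 0 (enum_rank e))) => y.
pose Y : 'M[F]_(k + p, k + q) :=
  \matrix_(r, s) (if insub (r, s) is Some c then y c else 0).
have YE (c : {c | c \in cells k p q}) : Y (val c).1 (val c).2 = y c.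
  by rewrite mxE -surjective_pairing valK.
transitivity (\sum_(e : E) v 0 (enum_rank e) *
    \prod_c Y (val c).1 (val c).2 ^+ e c).
  apply: eq_bigr => f _; congr (_ * _); apply: eq_bigr => c _.
  by rewrite YE.
apply: (@poly_zero_on_low_rank F k p q u.+1 (fun e => v 0 (enum_rank e))) => N Nk.
have [t <-] := mx_onto Nk.
under eq_bigr => f _ do rewrite aP mulr_sumr.
rewrite exchange_big big1 //= => j _.
have /rowP/(_ (enum_rank j)) := vA; rewrite !mxE.
rewrite (reindex (fun f : E => enum_rank f)) /=; last exact/onW_bij/enum_rank_bij.
move=> /(congr1 (fun z => z * b j t)); rewrite mul0r mulr_suml => vA0; rewrite -[RHS]vA0.
by apply: eq_bigr => f _; rewrite mxE !enum_rankK mulrA.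
Qed.

End Growth.

(** With [P] and [Q] fixed, the determinant of [P *m N *m Q] is a polynomial in
    the entries of [N]; it vanishes when [\rank N <= k], so it separates the
    given matrix from those of rank at most [k]. *)
Lemma rank_gt_minor (F : fieldType) n m k (N : 'M[F]_(n, m)) : (k < \rank N)%N ->
  exists (P : 'M_(k.+1, n)) (Q : 'M_(m, k.+1)), P *m N *m Q = 1%:M.
Proof.
move=> kN; exists (pid_mx k.+1 *m invmx (col_ebase N)), (invmx (row_ebase N) *m pid_mx k.+1).
rewrite -{2}(mulmx_ebase N) !mulmxA mulmxKV ?col_ebase_unit //.
rewrite mulmxK ?row_ebase_unit // !mul_pid_mx -pid_mx_1; congr pid_mx.
have := rank_leq_row N; have := rank_leq_col N; lia.
Qed.

Lemma expn_growth d c S :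
  (forall u, u.+1 ^ d <= S * (d * u).+1 ^ c)%N -> (d <= c)%N.
Proof.
move=> grow; rewrite leqNgt; apply/negP => cd.
have d_gt0 : (0 < d)%N by apply: leq_ltn_trans cd.
pose u := (S * d ^ c)%N; have := grow u; apply/negP; rewrite -ltnNge.
apply: (@leq_ltn_trans (S * (d * u.+1) ^ c)%N).
  rewrite leq_mul2l; case: (c) => [|c0]; first by rewrite !expn0 orbT.
  by rewrite leq_exp2r // mulnS -add1n leq_add2r d_gt0 orbT.
rewrite expnMn mulnA -/u; apply: (@leq_trans (u.+1 ^ c.+1)%N).
  by rewrite expnS ltn_mul2r expn_gt0 ltnSn.
exact: leq_pexp2l.
Qed.

(** Coordinates are taken in a basis of a complement of [W] followed by a basis
    of [W], so [W] is the vanishing locus of the first [c] coordinates.  The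
    matrices of rank at most [k] are closed, by their minors, so the section of
    their closure by [W] is trivial; comparing the two bounds for the growth
    yields the codimension. *)
Lemma dim_no_low_rank (F : closedFieldType) k p q (W : {vspace 'M[F]_(k + p, k + q)}) :
  (forall N, N \in W -> (\rank N <= k)%N -> N = 0) ->
  (k * (k + p + q) + \dim W <= (k + p) * (k + q))%N.
Proof.
move=> W0; pose c := \dim W^C; pose w := \dim W.
pose X : (c + w).-tuple 'M[F]_(k + p, k + q) := [tuple of vbasis W^C ++ vbasis W].
have XB : basis_of fullv X.
  rewrite -(addv_complf W) addvC; apply: cat_basis; try exact: vbasisP.
  by apply/directv_addP; rewrite capvC capv_compl.
have Xfree := basis_free XB.
have XE N : N = \sum_(l < c + w) coord X l N *: X`_l.
  exact: (coord_basis XB (memvf N)).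
pose T := {N : 'M[F]_(k + p, k + q) | (\rank N <= k)%N}.
pose x (N : T) (l : nat) := if insub l is Some l' then coord X l' (val N) else 0.
have x_ord N (l : 'I_(c + w)) : x N l = coord X l (val N) by rewrite /x valK.
have mx_linear (N : T) : val N = \sum_(l < c + w) x N l *: X`_l.
  by rewrite [LHS]XE; apply: eq_bigr => l _; rewrite x_ord.
have x_cone (N : T) a : exists N' : T, forall l, x N' l = a * x N l.
  have aN : (\rank (a *: val N) <= k)%N by rewrite (leq_trans (mxrank_scale _ _)) ?(valP N).
  exists (Sub (a *: val N) aN) => l; rewrite /x SubK.
  by case: insub => [l'|]; rewrite ?linearZ ?mulr0.
have closure_low_rank z : in_closure x (c + w) z ->
    (\rank (\sum_(l < c + w) z l *: X`_l)%R <= k)%N.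
  move=> zcl; rewrite leqNgt; apply/negP => /rank_gt_minor[P [Q PQ]].
  pose G : 'M[{mpoly F[c + w]}]_(k + p, k + q) :=
    \matrix_(i, j) \sum_(l < c + w) X`_l i j *: 'X_l.
  have GE y : map_mx (meval (prefix (c + w) y)) G = \sum_(l < c + w) y l *: X`_l.
    apply/matrixP => i j; rewrite !mxE rmorph_sum summxE; apply: eq_bigr => l _.
    by rewrite /= mevalZ mevalXU mxE mulrC.
  have cst y n m (M : 'M[F]_(n, m)) :
      map_mx (meval (prefix (c + w) y)) (map_mx (@mpolyC _ _) M) = M.
    by apply/matrixP => i j; rewrite !mxE mevalC.
  pose D := \det (map_mx (@mpolyC _ _) P *m G *m map_mx (@mpolyC _ _) Q).
  have DE y : D.@[prefix (c + w) y] = \det (P *m (\sum_(l < c + w) y l *: X`_l) *m Q).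
    by rewrite -det_map_mx !map_mxM !cst GE.
  have /eqP : D.@[prefix (c + w) z] = 0.
    apply: zcl => N; rewrite DE -mx_linear; apply/eqP; apply: contraT.
    rewrite -unitfE -unitmxE -row_free_unit => /eqP rk.
    have := leq_trans (mxrankM_maxl _ _) (mxrankM_maxr P (val N)).
    by move=> /(_ _ Q); rewrite rk => /leq_trans /(_ (valP N)); rewrite ltnn.
  by rewrite DE PQ det1 oner_eq0.
have [|S SP] := @spanned_section F T x x_cone c w.
  move=> z zcl zc i icw; pose N := \sum_(l < c + w) z l *: X`_l.
  suff N0 : N = 0.
    have /(congr1 (coord X (Ordinal icw))) := N0.
    by rewrite coord_sum_free // linear0.
  apply: W0; last exact: closure_low_rank.
  apply: memv_suml => l _; have [lc|cl] := ltnP l c; first by rewrite zc // scale0r mem0v.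
  apply/memvZ/vbasis_mem; rewrite nth_cat size_tuple ltnNge cl /=.
  by apply: mem_nth; rewrite size_tuple ltn_subLR.
have codim : (k * (k + p + q) <= c)%N.
  rewrite -card_cells; apply: (expn_growth (S := S)) => u.
  apply: (growth_lower_bound _ mx_linear (SP _)).
  by move=> N Nk; exists (Sub N Nk); rewrite SubK.
have dimM : \dim {: 'M[F]_(k + p, k + q)} = ((k + p) * (k + q))%N.
  by rewrite dimvf; apply: dim_matrix.
have wK : (w <= (k + p) * (k + q))%N by rewrite -dimM dimvS ?subvf.
by move: codim; rewrite /c dimv_compl dimM -/w => codim; rewrite -(subnK wK) leq_add2r.
Qed.

(** * Transitivity and the annihilator *)

Section Annihilator.

Variables (F : fieldType) (m n : nat).
Implicit Types (A : 'M[F]_(m, n)) (N : 'M[F]_(n, m)) (L : {vspace 'M[F]_(m, n)}).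

Definition trace_pairing L N : 'rV[F]_(\dim L) := \row_i \tr ((vbasis L)`_i *m N).

Fact trace_pairing_is_linear L : linear (trace_pairing L).
Proof.
by move=> a N N'; apply/rowP => i; rewrite !mxE mulmxDr -scalemxAr mxtraceD mxtraceZ.
Qed.

HB.instance Definition _ L := GRing.isLinear.Build F 'M[F]_(n, m) 'rV[F]_(\dim L) _
  (trace_pairing L) (trace_pairing_is_linear L).

Definition annihilator L : {vspace 'M[F]_(n, m)} := lker (linfun (trace_pairing L)).

Lemma annihilatorP L N :
  reflect (forall A, A \in L -> \tr (A *m N) = 0) (N \in annihilator L).
Proof.
rewrite memv_ker lfunE /=; apply: (iffP eqP) => [/rowP N0 A AL | N0].
  rewrite (coord_vbasis AL) mulmx_suml raddf_sum big1 // => i _.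
  by rewrite /= -scalemxAl mxtraceZ; have := N0 i; rewrite !mxE => ->; rewrite mulr0.
by apply/rowP => i; rewrite !mxE N0 // vbasis_mem // mem_nth ?size_tuple.
Qed.

Lemma dim_annihilator L : (m * n <= \dim (annihilator L) + \dim L)%N.
Proof.
have := limg_ker_dim (linfun (trace_pairing L)) fullv; rewrite capfv => dimE.
have <- : \dim {: 'M[F]_(n, m)} = (m * n)%N by rewrite dimvf mulnC; apply: dim_matrix.
rewrite -dimE leq_add2l; apply: leq_trans (dimvS (subvf _)) _.
by rewrite dimvf /dim /= mul1n.
Qed.

End Annihilator.

Lemma low_rank_factor (F : fieldType) n m k (N : 'M[F]_(n, m)) :
  (\rank N <= k)%N -> (k <= n)%N ->
  exists (x : k.-tuple 'cV[F]_n) (B : 'M[F]_(k, m)),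
    free x /\ N = (\matrix_(a, i) tnth x i a 0) *m B.
Proof.
move=> Nk kn; pose X : 'M[F]_(n, k) := col_ebase N *m pid_mx k.
exists [tuple col i X | i < k], (pid_mx (\rank N) *m row_ebase N); split.
  apply/freeP => c; under eq_bigr => i _ do rewrite -tnth_nth tnth_mktuple.
  move=> Xc; have /(congr1 (mulmx ((pid_mx k : 'M_(k, n)) *m invmx (col_ebase N)))) :
      X *m \col_i c i = 0.
    rewrite -[RHS]Xc; apply/colP => a; rewrite !mxE summxE.
    by apply: eq_bigr => i _; rewrite !mxE mulrC.
  rewrite mulmx0 /X !mulmxA mulmxKV ?col_ebase_unit // pid_mx_id // pid_mx_1 mul1mx.
  by move=> /colP c0 i; have := c0 i; rewrite !mxE.
have -> : (\matrix_(a, i) tnth [tuple col j X | j < k] i a 0) = X.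
  by apply/matrixP => a i; rewrite mxE tnth_mktuple mxE.
rewrite -{1}(mulmx_ebase N) /X mulmxA -(mulmxA _ (pid_mx k)) mul_pid_mx.
by congr (_ *m pid_mx _ *m _); lia.
Qed.

Section Duality.

Variables (F : fieldType) (m n k : nat) (L : {vspace 'M[F]_(m, n)}).

(** Factor [N = X B] with independent columns in [X].  By transitivity some [A]
    in [L] has [A X] equal to any prescribed unit matrix, and then
    [\tr (A N) = \tr (A X B)] is an entry of [B]. *)
Lemma k_transitive_annihilator N :
  (k <= n)%N -> k_transitive k L -> N \in annihilator L -> (\rank N <= k)%N -> N = 0.
Proof.
move=> kn trL /annihilatorP LN Nk.
have [x [B [xfree NE]]] := low_rank_factor Nk kn.
suff B0 : B = 0 by rewrite NE B0 mulmx0.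
apply/matrixP => i j; rewrite [RHS]mxE.
pose y := [tuple (if l == i then delta_mx j 0 else 0 : 'cV[F]_m) | l < k].
have [A AL Axy] := trL x y xfree.
have AX : A *m (\matrix_(a, l) tnth x l a 0) = delta_mx j i.
  apply/matrixP => a l; have /colP/(_ a) := Axy l; rewrite tnth_mktuple !mxE => E.
  rewrite (eq_bigr (fun b => A a b * tnth x l b 0)) => [|b _]; last by rewrite !mxE.
  by rewrite E; case: eqP => _; rewrite !mxE ?eqxx ?andbT ?andbF.
have := LN A AL; rewrite NE mulmxA AX /mxtrace (bigD1 j) //= big1 => [|l lj].
  rewrite addr0 mxE (bigD1 i) //= mxE !eqxx mul1r big1 ?addr0 // => l li.
  by rewrite mxE (negPf li) andbF mul0r.
by rewrite mxE big1 // => r _; rewrite mxE (negPf lj) mul0r.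
Qed.

(** Let [X] have columns [x].  If [B] annihilates the image of [L] under
    [A |-> A X], then [X B] annihilates [L] and has rank at most [k], so it is
    zero, and [B = 0] as the columns of [X] are independent.  A space with zero
    annihilator is everything. *)
Lemma annihilator_k_transitive :
  (forall N, N \in annihilator L -> (\rank N <= k)%N -> N = 0) -> k_transitive k L.
Proof.
move=> L0 x y xfree; pose X : 'M[F]_(n, k) := \matrix_(a, i) tnth x i a 0.
pose U := (linfun (mulmxr X) @: L)%VS.
have XU A : A \in L -> A *m X \in U.
  by move=> AL; rewrite -[A *m X](lfunE (mulmxr X) A) memv_img.
have annU : annihilator U = 0%VS.
  apply/eqP; rewrite -subv0; apply/subvP => B /annihilatorP UB; rewrite memv0.
  have XB : X *m B = 0.
    apply: L0; last exact: mulmx_max_rank.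
    by apply/annihilatorP => A AL; rewrite mulmxA UB // XU.
  apply/eqP/matrixP => i j; rewrite [RHS]mxE.
  have /freeP x_indep := xfree; apply: (x_indep (fun l => B l j)); transitivity (col j (X *m B)).
    apply/colP => a; rewrite summxE !mxE; apply: eq_bigr => l _.
    by rewrite !mxE -tnth_nth mulrC.
  by rewrite XB; apply/colP => a; rewrite !mxE.
have Ufull : U = fullv.
  apply/eqP; rewrite eqEdim subvf dimvf /=.
  by have := dim_annihilator U; rewrite annU dimv0 add0n.
have : \matrix_(a, i) tnth y i a 0 \in U by rewrite Ufull memvf.
case/memv_imgP => A AL; rewrite lfunE /= => YA; exists A => // i.
apply/colP => a; have /matrixP/(_ a i) := YA; rewrite !mxE => ->.
by apply: eq_bigr => b _; rewrite !mxE.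
Qed.

End Duality.

(** * A transitive space of minimal dimension *)

Section DiagonalSpace.

Variables (F : fieldType) (k p q : nat) (theta : 'I_(k + p) -> F).

(** Supported on the diagonal through [c], with the power [minn c.1 c.2] of the
    nodes [theta] as entries.  As [c] moves along a diagonal of length [l], this
    exponent takes the values 0, ..., l - 1 once each; cells with exponent below
    [k] are those of [cells k p q], so each diagonal gets its first [minn k l]
    moments. *)
Definition diagonal_mx (c : 'I_(k + p) * 'I_(k + q)) : 'M[F]_(k + p, k + q) :=
  \matrix_(i, j) if (i + c.2 == j + c.1)%N then theta i ^+ minn c.1 c.2 else 0.

Definition diagonal_space : {vspace 'M[F]_(k + p, k + q)} :=
  <<[seq diagonal_mx c | c <- enum (cells k p q)]>>%VS.

Lemma dim_diagonal_space : (\dim diagonal_space <= #|cells k p q|)%N.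
Proof. by apply: leq_trans (dim_span _) _; rewrite size_map -cardE. Qed.

Variable N : 'M[F]_(k + q, k + p).

(** The diagonal of a position, shifted to be a natural number. *)
Let delta (c : 'I_(k + p) * 'I_(k + q)) := (c.1 + (k + q - c.2))%N.

Let delta_eq c d : (delta c == delta d) = (c.1 + d.2 == d.1 + c.2)%N.
Proof. by rewrite /delta; have := ltn_ord c.2; have := ltn_ord d.2; lia. Qed.

Let delta_inj c d : delta c = delta d -> c.1 = d.1 -> c = d.
Proof.
move=> /eqP; rewrite delta_eq; case: c d => [i j] [i' j'] /= + ii'.
by rewrite ii' eqn_add2l => /eqP jj'; congr pair; apply: val_inj.
Qed.

Variable d0 : 'I_(k + p) * 'I_(k + q).

Let D := [set c | (N c.2 c.1 != 0) && (delta c == delta d0)].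

(** A diagonal with more than [e] positions contains a cell of exponent [e]. *)
Lemma diagonal_moment e : N \in annihilator diagonal_space ->
  (e < k)%N -> (e < #|D|)%N -> \sum_(c in D) theta c.1 ^+ e * N c.2 c.1 = 0.
Proof.
move=> /annihilatorP N0 ek eD.
have [c cD ce] : exists2 c, c \in D & (e <= minn c.1 c.2)%N.
  apply/exists_inP; apply: contraLR eD; rewrite negb_exists_in -leqNgt => /forall_inP De.
  rewrite cardE -(size_map (fun c : 'I_(k + p) * 'I_(k + q) => minn c.1 c.2)).
  rewrite -[leqRHS](size_iota 0 e).
  apply: uniq_leq_size => [|_ /mapP[c + ->]]; last first.
    by rewrite mem_enum mem_iota => /De; rewrite -ltnNge.
  rewrite map_inj_in_uniq ?enum_uniq // => c d; rewrite !mem_enum !inE.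
  move=> /andP[_ /eqP dc] /andP[_ /eqP dd] cd.
  have dcd : delta c = delta d by rewrite dc dd.
  apply: (delta_inj dcd); apply: val_inj => /=.
  by move/eqP: dcd; rewrite delta_eq; lia.
(* Go back along the diagonal from c to the cell of exponent e. *)
pose s := (minn c.1 c.2 - e)%N.
have c1 : (c.1 - s < k + p)%N by apply: leq_ltn_trans (leq_subr _ _) (ltn_ord _).
have c2 : (c.2 - s < k + q)%N by apply: leq_ltn_trans (leq_subr _ _) (ltn_ord _).
pose c' := (Ordinal c1, Ordinal c2).
have c'e : minn c'.1 c'.2 = e 
  by rewrite /= /s; move: ce; move: (nat_of_ord c.1) (nat_of_ord c.2) => a b; lia.
have c'cells : c' \in cells k p q by rewrite inE -gtn_min c'e.
have := N0 (diagonal_mx c'); rewrite memv_span; last first.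
  by apply: map_f; rewrite mem_enum.
move=> /(_ isT); rewrite /mxtrace => trE; rewrite -[RHS]trE.
under [RHS]eq_bigr => i _ do rewrite mxE.
rewrite pair_bigA /= [LHS]big_mkcond; apply: eq_bigr => -[i j] _ /=.
rewrite !mxE c'e inE /= delta_eq; move: cD; rewrite inE delta_eq /= => /andP[_ cd].
have -> : (i + (c.2 - s) == j + (c.1 - s))%N = (i + d0.2 == d0.1 + j)%N.
  move: cd ce; rewrite /s; move: (nat_of_ord c.1) (nat_of_ord c.2).
  by move: (nat_of_ord d0.1) (nat_of_ord d0.2) (nat_of_ord i) (nat_of_ord j); lia.
case: (_ == _ + j)%N => /=; last by rewrite andbF mul0r.
by rewrite andbT; case: eqP => // ->; rewrite mulr0.
Qed.

Hypothesis d0_min : forall c, N c.2 c.1 != 0 -> (delta d0 <= delta c)%N.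

(** The submatrix through the positions of [D] is triangular, because entries of
    [N] on smaller diagonals vanish.  Concretely, in a vanishing combination of
    the columns involved, look at the last one with nonzero coefficient, in the
    row where it meets [D]. *)
Lemma diagonal_rank : (#|D| <= \rank N)%N.
Proof.
pose col (l : 'I_#|D|) := (enum_val l).1.
suff /eqP <- : row_free (rowsub col N^T).
  by rewrite rowsubE; apply: leq_trans (mxrankM_maxr _ _) _; rewrite mxrank_tr.
apply/inj_row_free => v vN; apply/rowP => l1; rewrite [RHS]mxE; apply/eqP.
apply: contraT => vl1.
have [l vl lmax] := arg_maxnP (fun l => col l : nat) (P := fun l => v 0 l != 0) vl1.
have D_val (r : 'I_#|D|) :
    N (enum_val r).2 (enum_val r).1 != 0 /\ delta (enum_val r) = delta d0.
  by have := enum_valP r; rewrite inE => /andP[Nr /eqP dr].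
have [Nl dl] := D_val l.
have /rowP/(_ (enum_val l).2) := vN; rewrite !mxE (bigD1 l) //= !mxE.
rewrite big1 ?addr0 => [/eqP|l' ll']; first by rewrite mulf_eq0 (negPf vl) (negPf Nl).
have [->|vl'] := eqVneq (v 0 l') 0; first by rewrite mul0r.
rewrite !mxE; apply/eqP; rewrite mulf_eq0 (negPf vl') /=; apply: contraT => Nl'.
have [_ dl'] := D_val l'.
have := d0_min (c := (col l', (enum_val l).2)) Nl'; rewrite -dl /delta /= leq_add2r => lel'.
case/eqP: ll'; apply: enum_val_inj; apply: delta_inj; first by rewrite dl dl'.
by apply: val_inj; apply/eqP; rewrite eqn_leq lel' andbT; apply: lmax.
Qed.

(** Otherwise a polynomial of degree below both [k] and the length of the
    diagonal vanishes at all nodes of [D] but that of [d0], and the moments of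
    [N] isolate the entry at [d0]. *)
Lemma diagonal_large : injective theta -> N \in annihilator diagonal_space ->
  N d0.2 d0.1 != 0 -> (k < #|D|)%N.
Proof.
move=> theta_inj NL N0; rewrite ltnNge; apply/negP => Dk.
have d0D : d0 \in D by rewrite inE N0 eqxx.
pose f : {poly F} := \prod_(c in D :\ d0) ('X - (theta c.1)%:P).
have f_size : size f = #|D|.
  rewrite /f -big_enum /= size_prod_XsubC -cardE.
  by rewrite [in RHS](cardsD1 d0) d0D.
have : \sum_(c in D) f.[theta c.1] * N c.2 c.1 = 0.
  transitivity (\sum_(e < size f) f`_e * \sum_(c in D) theta c.1 ^+ e * N c.2 c.1).
    under [RHS]eq_bigr => e _ do rewrite mulr_sumr.
    rewrite exchange_big /=; apply: eq_bigr => c _; rewrite horner_coef mulr_suml.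
    by apply: eq_bigr => e _; rewrite mulrA.
  apply: big1 => e _; have eD : (e < #|D|)%N by rewrite -f_size.
  by rewrite diagonal_moment ?mulr0 // (leq_trans eD).
rewrite (big_setD1 d0) //= [X in _ + X]big1 ?addr0 => [/eqP|c cD]; last first.
  by rewrite /f horner_prod (big_setD1 c) //= hornerXsubC subrr !mul0r.
rewrite mulf_eq0 (negPf N0) orbF /f horner_prod => /prodf_eq0[c].
rewrite in_setD1 => /andP[cd0 /setIdP[_ /eqP dc]].
rewrite hornerXsubC subr_eq0 => /eqP/theta_inj dcE.
by case/eqP: cd0; apply: delta_inj.
Qed.

End DiagonalSpace.

Lemma diagonal_space_annihilator (F : fieldType) k p q (theta : 'I_(k + p) -> F)
    (N : 'M[F]_(k + q, k + p)) :
  injective theta -> N \in annihilator (diagonal_space q theta) ->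
  (\rank N <= k)%N -> N = 0.
Proof.
move=> theta_inj NL; apply: contraTeq => N0; rewrite -ltnNge.
have [c Nc] : exists c : 'I_(k + p) * 'I_(k + q), N c.2 c.1 != 0.
  apply: contrapT => /forallNP Nz; case/eqP: N0; apply/matrixP => j i.
  by have /negP/negPn/eqP := Nz (i, j); rewrite mxE.
have [d Nd d_min] := arg_minnP (fun c : 'I_(k + p) * 'I_(k + q) => c.1 + (k + q - c.2))%N
  (P := fun c => N c.2 c.1 != 0) Nc.
exact: leq_trans (diagonal_large theta_inj NL Nd) (diagonal_rank d_min).
Qed.

Theorem theorem1p2 (R : realType) (m n k : nat)
    (hm : (0 < m)%N) (hn : (0 < n)%N) (hk : (0 < k)%N)
    (hkmn : (k < minn m n)%N) :
  (forall L : {vspace 'M[complex R]_(m, n)},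
      k_transitive k L -> (k * (m + n - k) <= \dim L)%N) /\
  (exists2 L : {vspace 'M[complex R]_(m, n)},
      k_transitive k L & \dim L = (k * (m + n - k))%N).
Proof.
move: hkmn hm hn => /[!leq_min] /andP[/ltnW/subnKC <- /ltnW/subnKC <-] _ _.
move: (m - k)%N (n - k)%N => p q.
have -> : (k * (k + p + (k + q) - k) = k * (k + p + q))%N by congr (_ * _)%N; lia.
have lower (L : {vspace 'M[complex R]_(k + p, k + q)}) :
    k_transitive k L -> (k * (k + p + q) <= \dim L)%N.
  move=> trL; have kq := leq_addr q k.
  have := @dim_no_low_rank _ k q p (annihilator L) (fun N => k_transitive_annihilator kq trL).
  have := dim_annihilator L; move: (\dim _) (\dim L) => a b; nia.
split=> //; pose theta (i : 'I_(k + p)) : complex R := i%:R.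
have theta_inj : injective theta.
  by move=> i j /eqP; rewrite /theta Num.Theory.eqr_nat => /eqP/val_inj.
have trL : k_transitive k (diagonal_space q theta).
  by apply: annihilator_k_transitive => N; apply: diagonal_space_annihilator.
exists (diagonal_space q theta) => //; apply/eqP; rewrite eqn_leq lower // andbT.
by rewrite -card_cells dim_diagonal_space.
Qed.
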